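(* Assume $n$ is even. Let $\phi:H_{\bar0}\to W_{\bar1}$ be a $\mathbb Z$-homogeneous derivation (i.e. $\phi([x,y])=[\phi(x),y]+[x,\phi(y)]$ for $x,y\in H_{\bar0}$) with $\phi((H_{\bar0})_{-1}\oplus(H_{\bar0})_0)=0$. Then $\phi=0$.
   Context: Let $\mathbb F$ be an algebraically closed field of characteristic $p>3$. Fix positive integers $m=2r$ and $n$; write $n=2s$ if $n$ is even and $n=2s+1$ if $n$ is odd. Put $I_0=\{1,\dots,m\}$, $I_1=\{m+1,\dots,m+n\}$, $I=I_0\cup I_1$. Fix positive integers $t_1,\dots,t_m$, put $\pi=(\pi_1,\dots,\pi_m)$ with $\pi_i=p^{t_i}-1$, and $\mathbb A=\{\alpha\in\mathbb N_0^m:\alpha_i\le\pi_i\ \forall i\}$; $\varepsilon_i$ is the $i$-th unit vector and $|\alpha|=\sum\alpha_i$. Let $\mathbb B$ be the set of strictly increasing sequences $u=\langle i_1<\dots<i_k\rangle$ of elements of $I_1$ (including $\emptyset$), $|u|=k$, $\mathbb B^0=\{u\in\mathbb B:|u|\text{ even}\}$, $\omega=\langle m+1,\dots,m+n\rangle$. Let $\mathcal O=\mathcal O(m,n;\underline t)$ be the supercommutative associative superalgebra with basis $x^{(\alpha)}x^u$ ($\alpha\in\mathbb A,u\in\mathbb B$), where $x^{(\alpha)}x^{(\beta)}=\binom{\alpha+\beta}{\alpha}x^{(\alpha+\beta)}$, $x^{(\alpha)}$ even, $x_{m+1},\dots,x_{m+n}$ odd and pairwise anticommuting, $x^u=x_{i_1}\cdots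 x_{i_k}$, $x^\emptyset=1$, $x_i:=x^{(\varepsilon_i)}$ for $i\in I_0$, $\mathbb Z$-graded by $\mathrm{zd}(x^{(\alpha)}x^u)=|\alpha|+|u|$. For $i\in I$ let $\partial_i$ be the superderivation of $\mathcal O$ with $\partial_i(x^{(\alpha)})=x^{(\alpha-\varepsilon_i)}$ for $i\in I_0$ and $\partial_i(x_k)=\delta_{ik}$ for $i\in I_1$; parity $\mu(i)=\bar0$ for $i\in I_0$, $\mu(i)=\bar1$ for $i\in I_1$. $W=\{\sum_{i\in I}f_i\partial_i: f_i\in\mathcal O\}$ is the Lie superalgebra with bracket $[f\partial_i,g\partial_j]=f\partial_i(g)\partial_j-(-1)^{p(f\partial_i)p(g\partial_j)}g\partial_j(f)\partial_i$, $\mathbb Z$-graded by $\mathrm{zd}(f\partial_j)=\mathrm{zd}(f)-1$, with even and odd parts $W_{\bar 0},W_{\bar1}$. Define $i'=i+r$ ($1\le i\le r$), $i'=i-r$ ($r<i\le m$), $i'=i+s$ ($m<i\le m+s$), $i'=i-s$ ($m+s<i\le m+2s$), $i'=i$ otherwise; $\tau(i)=1$ for $1\le i\le r$, $\tau(i)=-1$ for $r<i\le m$, $\tau(i)=1$ for $i\in I_1$. For $f\in\mathcal O$ put $D_H(f)=\sum_{i\in I}\tau(i)(-1)^{\mu(i)p(f)}\partial_i(f)\partial_{i'}$. Let $H_{\bar0}=\mathrm{span}_{\mathbb F}\{D_H(x^{(\alpha)}x^u):\alpha\in\mathbb A,u\in\mathbb B^0,(\alpha,u)\ne(\pi,\omega)\}$,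 a $\mathbb Z$-graded subalgebra of $W_{\bar0}$ with $\mathrm{zd}(D_H(f))=\mathrm{zd}(f)-2$ and homogeneous components $(H_{\bar0})_k$. A linear map between $\mathbb Z$-graded spaces is $\mathbb Z$-homogeneous of degree $d$ if it maps degree $k$ into degree $k+d$. *)

(* Defs.v *)
From HB Require Import structures.
From mathcomp Require Import all_boot all_order all_algebra.
Set Implicit Arguments. Unset Strict Implicit. Unset Printing Implicit Defensive.
Import GRing.Theory.
Local Open Scope ring_scope.

(* Indices are 0-based: the paper's index i in {1,...,m+n} is our i-1 in 'I_(2*r+n);
   I_0 = {0,...,2r-1} (even), I_1 = {2r,...,2r+n-1} (odd); the odd index 2r+k
   corresponds to the odd generator x_{m+1+k}, k : 'I_n. *)
Section HamiltonianSuperalgebra.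
Variable F : fieldType.
Variables (p r n : nat) (t : 'I_(2*r) -> nat).

Definition dexp := {dffun forall i : 'I_(2*r), 'I_(p ^ t i)}.
(* basis monomials x^(alpha) x^u, u a subset of I_1 (listed increasingly) *)
Definition mon := (dexp * {set 'I_n})%type.
(* O(m,n;t): coefficient functions on the monomial basis *)
Definition Oalg := {ffun mon -> F^o}.
HB.instance Definition _ := GRing.Lmodule.copy Oalg ({ffun mon -> F^o} : lmodType F).
(* W = { sum_i f_i d_i } : the coefficient f_i is D i *)
Definition Wder := {ffun 'I_(2*r + n) -> Oalg}.
HB.instance Definition _ := GRing.Lmodule.copy Wder ({ffun 'I_(2*r + n) -> Oalg} : lmodType F).

Definition basisO (g : mon) : Oalg := [ffun h => (h == g)%:R].

Definition zdeg (g : mon) : nat := (\sum_(i < 2*r) val (g.1 i) + #|g.2|)%N.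

Definition mu (i : 'I_(2*r + n)) : bool := (2*r <= i)%N.

(* divided power multiplication in O:
   x^(a)x^u * x^(b)x^v = prod_i C(a_i+b_i,a_i) x^(a+b) x^u x^v,
   x^u x^v = 0 if u,v meet, else (-1)^{#{(c,d) in u*v | d<c}} x^(u \cup v);
   x^(a+b) = 0 if a+b is not in A. *)
Definition mulO (f g : Oalg) : Oalg := [ffun c : mon =>
  \sum_(a : mon) \sum_(b : mon |
      [forall i, val (c.1 i) == (val (a.1 i) + val (b.1 i))%N]
      && (c.2 == a.2 :|: b.2) && [disjoint a.2 & b.2])
    (((\prod_(i < 2*r) 'C(val (c.1 i), val (a.1 i)))%N)%:R
      * (-1) ^+ #|[set x : 'I_n * 'I_n | (x.1 \in a.2) && (x.2 \in b.2) && (x.2 < x.1)%N]|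
      * f a * g b)].

Definition dpart (i : 'I_(2*r + n)) (f : Oalg) : Oalg := [ffun g : mon =>
  if (i < 2*r)%N then
    (* coefficient of x^(alpha) in d_i f is the coefficient of x^(alpha+eps_i) in f *)
    \sum_(b : dexp | [forall j : 'I_(2*r), val (b j) == (val (g.1 j) + (val j == val i))%N])
       f (b, g.2)
  else
    (* d_k (x^(alpha) x^(u + k)) = (-1)^{#{a in u | a < k}} x^(alpha) x^u *)
    \sum_(k : 'I_n | (val k == i - 2*r)%N)
       (if k \in g.2 then 0
        else (-1) ^+ #|[set a in g.2 | (a < k)%N]| * f (g.1, k |: g.2))].

Definition parO (b : bool) (f : Oalg) : Oalg :=
  [ffun g : mon => if odd #|g.2| == b then f g else 0].

Definition actW (D : Wder) (f : Oalg) : Oalg := \sum_(i < 2*r + n) mulO (D i) (dpart i f).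

(* parity projection of W: p(f d_i) = p(f) + mu(i) *)
Definition parW (b : bool) (D : Wder) : Wder :=
  [ffun i => parO (b (+) mu i) (D i)].

(* bracket of homogeneous D (parity a) and E (parity b):
   [D,E] = sum_j (D(E_j) - (-1)^{ab} E(D_j)) d_j,
   which is the bilinear extension of
   [f d_i, g d_j] = f d_i(g) d_j - (-1)^{p(f d_i)p(g d_j)} g d_j(f) d_i *)
Definition hbr (a b : bool) (D E : Wder) : Wder :=
  [ffun j => if a && b then actW D (E j) + actW E (D j)
             else actW D (E j) - actW E (D j)].

Definition bracket (D E : Wder) : Wder :=
  \sum_(a : bool) \sum_(b : bool) hbr a b (parW a D) (parW b E).

Definition Wodd (D : Wder) : Prop := parW true D = D.

(* W_k : zd(f d_j) = zd(f) - 1 *)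
Definition Wdeg (k : int) (D : Wder) : Prop :=
  forall (i : 'I_(2*r + n)) (g : mon), D i g != 0 -> (zdeg g)%:Z - 1 = k.

Definition primen (i : nat) : nat :=
  if (i < r)%N then (i + r)%N
  else if (i < 2*r)%N then (i - r)%N
  else if (i < 2*r + n./2)%N then (i + n./2)%N
  else if (i < 2*r + 2 * n./2)%N then (i - n./2)%N
  else i.
Definition iprime (i : 'I_(2*r + n)) : 'I_(2*r + n) := insubd i (primen i).

Definition tau (i : 'I_(2*r + n)) : F := if (r <= i < 2*r)%N then -1 else 1.

Definition DHh (b : bool) (f : Oalg) : Wder :=
  \sum_(i < 2*r + n)
     [ffun j => if j == iprime i then (tau i * (-1) ^+ (mu i && b)) *: dpart i f else 0].

Definition DH (f : Oalg) : Wder := DHh false (parO false f) + DHh true (parO true f).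

Definition isTop (g : mon) : bool :=
  [forall i, val (g.1 i) == (p ^ t i).-1] && (g.2 == setT).

Definition hgen (g : mon) : bool := ~~ odd #|g.2| && ~~ isTop g.

Definition inH0 (D : Wder) : Prop :=
  exists c : mon -> F, D = \sum_(g | hgen g) c g *: DH (basisO g).

End HamiltonianSuperalgebra.
Arguments Wder F p r n t : clear implicits.

(* Main.v *)
(* For odd indices a, b = a', the element D_H(x_a x_b) = x_b d_b - x_a d_a has
   degree 0, hence is killed by phi, and it acts diagonally on W: on a monomial
   x^(alpha) x^u d_j by [b in u] - [a in u] - [j = b] + [j = a].  So phi preserves
   all these weights modulo p; the weights compared differ by at most 3 < p, hence
   they agree as integers.  Since n is even the pairs {a, a'} exhaust the odd
   indices, and the sum of all weights has the parity of |u| + mu(j): even on H_0,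
   odd on the odd part of W. *)
Require Import Defs.
From HB Require Import structures.
From mathcomp Require Import all_boot all_order all_algebra.
From mathcomp Require Import zify.
Set Implicit Arguments. Unset Strict Implicit.
Import GRing.Theory.
Local Open Scope ring_scope.

(** * Parity and size of integer weights *)

(** The pairs {k, k+s} partition the indices, so the sum regroups into terms G k + G (k+s), each
    even. It is used with s = n/2, where the pairs are {a, a'}. *)
Lemma sum_even_pairs (n s : nat) (G : 'I_n -> nat) :
  n = (s + s)%N ->
  (forall k l : 'I_n, val l = (val k + s)%N -> ~~ odd (G k + G l)) ->
  ~~ odd (\sum_(k < n) G k).
Proof.
move=> e; move: G; rewrite e => G hG.
rewrite big_split_ord /= -big_split /=.
elim/big_ind: _ => //= [x y hx hy|i _]; first by rewrite oddD (negbTE hx) (negbTE hy).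
by apply: hG => /=; rewrite addnC.
Qed.

(** Three of the bits carry a plus sign and three a minus sign. This bound is what makes p > 3
    sufficient to lift a congruence of weights to an equality. *)
Lemma weight_gap_le3 (b1 b2 b3 b4 b5 b6 : bool) :
  (absz (b1%:Z - b2%:Z - (b3%:Z - b4%:Z) - (b5%:Z - b6%:Z))%R <= 3)%N.
Proof. by case: b1; case: b2; case: b3; case: b4; case: b5; case: b6. Qed.

(** Modulo 2 the signs disappear, so the equation says that the six bits have an even sum. The bits
    are grouped by odd index, first those of a, then those of b. *)
Lemma weight_parity (b1 b2 b3 b4 b5 b6 : bool) :
  b1%:Z - b2%:Z - (b3%:Z - b4%:Z) = b5%:Z - b6%:Z ->
  ~~ odd ((b3 + b6 + b4) + (b1 + b5 + b2))%N.
Proof. by case: b1; case: b2; case: b3; case: b4; case: b5; case: b6. Qed.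

Lemma intr_small_eq0 (F : fieldType) (p : nat) (c : int) :
  p \in [pchar F] -> (`|c| < p)%N -> c%:~R = 0 :> F -> c = 0.
Proof.
move=> hchar hc h0.
have : (`|c|%N)%:R = 0 :> F.
  by case: c h0 {hc} => k //=; rewrite NegzE rmorphN /= => /eqP; rewrite oppr_eq0 => /eqP.
move/eqP; rewrite -(dvdn_pcharf hchar) => /dvdnP [q hq].
case: q hq => [|q] hq; lia.
Qed.

(** * Derivatives of monomials, bilinearity, and the bracket with an even element *)

Section Torus.
Variables (F : fieldType) (p r n : nat) (t : 'I_(2*r) -> nat).
Implicit Types (f : Oalg F p n t) (D E : Wder F p r n t) (g h : mon p n t).
Implicit Types (i j : 'I_(2*r + n)) (k l : 'I_n).

(** [primen] never leaves the index range, so the default value of [insubd] is never taken. *)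
Lemma iprime_val i : iprime i = primen r n i :> nat.
Proof.
rewrite /iprime -[LHS]/(val _) val_insubd; case: ifP => // /negbT; rewrite /primen.
have := ltn_ord i; do ![case: ifP => ?]; lia.
Qed.

Lemma iprimeK : involutive (@iprime r n).
Proof.
move=> i; apply: ord_inj; rewrite !iprime_val.
have: primen r n i = primen r n i by [].
move: {2}(primen r n i) => q; rewrite /primen.
have := ltn_ord i; do ![case: ifP => ?]; lia.
Qed.

Lemma mu_rshift k : mu (rshift (2 * r) k).
Proof. by rewrite /mu /= leq_addr. Qed.

Lemma mu_lshift (i : 'I_(2*r)) : mu (lshift n i) = false.
Proof. by rewrite /mu /= leqNgt ltn_ord. Qed.

Lemma WscaleE (x : F) E j g : (x *: E) j g = x * E j g.
Proof. by rewrite !ffunE. Qed.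

Lemma dpart_oddE k f g : dpart (rshift (2 * r) k) f g =
  if k \in g.2 then 0 else (-1) ^+ #|[set a in g.2 | (a < k)%N]| * f (g.1, k |: g.2).
Proof.
rewrite ffunE /= ltnNge leq_addr /= (big_pred1 k) // => l /=.
by rewrite addKn.
Qed.

Lemma dpart_odd_basis k h g :
  dpart (rshift (2 * r) k) (basisO F h) g != 0 -> k \notin g.2 /\ h.2 = k |: g.2.
Proof.
rewrite dpart_oddE; case: ifP => [_|hk]; first by rewrite eqxx.
by rewrite ffunE; case: (eqVneq _ h) => [<-|_]; rewrite ?mulr0 ?eqxx.
Qed.

Lemma dpart_even_basis (i : 'I_(2*r)) h g :
  dpart (lshift n i) (basisO F h) g != 0 ->
  h.2 = g.2 /\ forall l : 'I_(2*r), val (h.1 l) = (val (g.1 l) + (l == i))%N.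
Proof.
rewrite ffunE /= ltn_ord => hn0.
have [b hb hb0] : exists2 b : dexp p t,
    [forall j, val (b j) == (val (g.1 j) + (val j == val i))%N] & basisO F h (b, g.2) != 0.
  apply/exists_inP; apply: contraNT hn0; rewrite negb_exists_in => /forall_inP H.
  by apply/eqP/big1 => b /H; rewrite negbK => /eqP.
move: hb0; rewrite ffunE; case: (eqVneq _ h) => [<- _|_]; last by rewrite eqxx.
by split=> // j; rewrite (eqP (forallP hb j)).
Qed.

Lemma parO_basis h (b : bool) : odd #|h.2| = b -> parO b (basisO F h) = basisO F h.
Proof.
move=> hb; apply/ffunP => g; rewrite !ffunE.
by case: (eqVneq g h) => [->|_]; [rewrite hb eqxx | case: ifP].
Qed.

Lemma parO_basis0 h (b : bool) : odd #|h.2| != b -> parO b (basisO F h) = 0.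
Proof.
move=> hb; apply/ffunP => g; rewrite !ffunE.
by case: (eqVneq g h) => [->|_]; [rewrite (negbTE hb) | case: ifP].
Qed.

Lemma dpart0 i : dpart i 0 = 0 :> Oalg F p n t.
Proof.
apply/ffunP => g; rewrite !ffunE; case: ifP => _; apply: big1 => k _; rewrite ?ffunE //.
by case: ifP; rewrite ?mulr0.
Qed.

(** As the prime is an involution, only the summand i = j' of D_H reaches component j. The monomial
    is even, so the parity sign is trivial and the odd half of [DH] vanishes. *)
Lemma DH_basisE h j : ~~ odd #|h.2| ->
  DH (basisO F h) j = tau F (iprime j) *: dpart (iprime j) (basisO F h).
Proof.
move=> ho; rewrite /DH parO_basis ?(negbTE ho) // parO_basis0 ?(negbTE ho) // /DHh.
rewrite ffunE !sum_ffunE (bigD1 (iprime j)) //= big1 ?addr0; last first.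
  by move=> i hi; rewrite ffunE; case: (eqVneq j (iprime i)) hi => [->|//]; rewrite iprimeK eqxx.
rewrite ffunE iprimeK eqxx andbF mulr1 big1 ?addr0 //.
by move=> i _; rewrite ffunE dpart0 scaler0; case: ifP.
Qed.

Lemma mul0O f : mulO 0 f = 0.
Proof.
apply/ffunP => g; rewrite !ffunE; apply: big1 => a _; apply: big1 => b _.
by rewrite ffunE mulr0 mul0r.
Qed.

Lemma mulO0 f : mulO f 0 = 0.
Proof.
apply/ffunP => g; rewrite !ffunE; apply: big1 => a _; apply: big1 => b _.
by rewrite ffunE mulr0.
Qed.

Lemma mulNO f1 f2 : mulO (- f1) f2 = - mulO f1 f2.
Proof.
apply/ffunP => g; rewrite !ffunE -sumrN; apply: eq_bigr => a _.
by rewrite -sumrN; apply: eq_bigr => b _; rewrite ffunE mulrN mulNr.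
Qed.

Lemma mulON f1 f2 : mulO f1 (- f2) = - mulO f1 f2.
Proof.
apply/ffunP => g; rewrite !ffunE -sumrN; apply: eq_bigr => a _.
by rewrite -sumrN; apply: eq_bigr => b _; rewrite ffunE mulrN.
Qed.

Lemma mulOD f f1 f2 : mulO f (f1 + f2) = mulO f f1 + mulO f f2.
Proof.
apply/ffunP => g; rewrite !ffunE -big_split; apply: eq_bigr => a _ /=.
by rewrite -big_split; apply: eq_bigr => b _; rewrite ffunE mulrDr.
Qed.

Lemma mulDO f f1 f2 : mulO (f1 + f2) f = mulO f1 f + mulO f2 f.
Proof.
apply/ffunP => g; rewrite !ffunE -big_split; apply: eq_bigr => a _ /=.
by rewrite -big_split; apply: eq_bigr => b _; rewrite ffunE mulrDr mulrDl.
Qed.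

Lemma dpartN i f : dpart i (- f) = - dpart i f.
Proof.
apply/ffunP => g; rewrite !ffunE; case: ifP => _; rewrite -sumrN; apply: eq_bigr => b _.
  by rewrite ffunE.
by rewrite ffunE mulrN; case: ifP; rewrite ?oppr0.
Qed.

Lemma dpartD i f1 f2 : dpart i (f1 + f2) = dpart i f1 + dpart i f2.
Proof.
apply/ffunP => g; rewrite !ffunE; case: ifP => _; rewrite -big_split; apply: eq_bigr => b _ /=.
  by rewrite ffunE.
by rewrite ffunE mulrDr; case: ifP; rewrite ?addr0.
Qed.

Lemma actW0l f : actW 0 f = 0 :> Oalg F p n t.
Proof. by apply: big1 => i _; rewrite ffunE mul0O. Qed.

Lemma actW0r D : actW D 0 = 0.
Proof. by apply: big1 => i _; rewrite dpart0 mulO0. Qed.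

Lemma actWDl D E f : actW (D + E) f = actW D f + actW E f.
Proof. by rewrite /actW -big_split; apply: eq_bigr => i _; rewrite ffunE mulDO. Qed.

Lemma actWDr D f1 f2 : actW D (f1 + f2) = actW D f1 + actW D f2.
Proof. by rewrite /actW -big_split; apply: eq_bigr => i _; rewrite dpartD mulOD. Qed.

Lemma actWN D f : actW D (- f) = - actW D f.
Proof. by rewrite /actW -sumrN; apply: eq_bigr => i _; rewrite dpartN mulON. Qed.

Lemma hbr0l a b E : hbr a b 0 E = 0.
Proof.
apply/ffunP => j; rewrite !ffunE actW0l actW0r.
by case: ifP => _; rewrite ?subr0 ?addr0.
Qed.

Lemma parWD D : parW false D + parW true D = D.
Proof.
apply/ffunP => j; apply/ffunP => g; rewrite !ffunE.
by case: (odd _); case: (mu j); rewrite /= ?addr0 ?add0r.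
Qed.

Lemma parW0 b : parW b 0 = 0 :> Wder F p r n t.
Proof. by apply/ffunP => j; apply/ffunP => g; rewrite !ffunE; case: ifP. Qed.

Lemma bracket0l E : bracket 0 E = 0.
Proof. by apply: big1 => a _; apply: big1 => b _; rewrite parW0 hbr0l. Qed.

(** With an even left argument the sign is a minus for both parities of E, so the even and odd parts
    of E recombine. *)
Lemma bracket_even D E j : parW false D = D ->
  bracket D E j = actW D (E j) - actW E (D j).
Proof.
move=> hD; have hD1 : parW true D = 0.
  by apply: (addrI D); rewrite addr0 -{1}hD parWD.
rewrite /bracket !big_bool /= hD hD1 !hbr0l !add0r !ffunE /=.
rewrite -[in RHS](parWD E) actWDl [in RHS]ffunE actWDr opprD !ffunE.
by rewrite addrACA; congr (_ + _); rewrite addrC.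
Qed.

(** * The torus element D_H(x_a x_b) with b = a', and its weights *)

Variables (z : dexp p t) (a b : 'I_n).
Hypothesis hz : forall i : 'I_(2 * r), val (z i) = 0%N.
Hypothesis hn : ~~ odd n.
Hypothesis hab : val b = (val a + n./2)%N.

(** Since [z] is the zero exponent, this is the odd generator x_k; likewise [(z, set0)] stands for
    the unit 1. *)
Let x1 k : Oalg F p n t := basisO F (z, [set k]).

(** The operator x_k d_k is the projection onto monomials containing x_k. Only the product x_k x^(u
    - k) contributes to x^u, and its sign counts the elements of u below k, exactly as the sign of
    d_k does; the two signs cancel. *)
Lemma mulO_x1_dpart k f g :
  mulO (x1 k) (dpart (rshift (2 * r) k) f) g = if k \in g.2 then f g else 0.
Proof.
rewrite ffunE (bigD1 (z, [set k])) //= [X in _ + X]big1 ?addr0; last first.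
  move=> c hc; apply: big1 => d _; by rewrite ffunE (negbTE hc) mulr0 mul0r.
have hP (c : mon p n t) :
   ([forall i, val (g.1 i) == (val (z i) + val (c.1 i))%N] && (g.2 == [set k] :|: c.2)
    && [disjoint [set k] & c.2]) = (k \in g.2) && (c == (g.1, g.2 :\ k)).
  rewrite disjoints1; apply/andP/andP => [[/andP [/forallP h1 /eqP h2] h3]|[hk /eqP ->]] /=.
    rewrite h2 setU11; split=> //; case: c h1 h2 h3 => c1 c2 /= h1 h2 h3.
    rewrite xpair_eqE; apply/andP; split; last by rewrite setU1K.
    apply/eqP/ffunP => i; apply/val_inj.
    by move/eqP: (h1 i); rewrite hz add0n => /esym.
  by rewrite setD1K // eqxx !inE eqxx andbT; split=> //; apply/forallP => i; rewrite hz.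
rewrite (eq_bigl (fun c => (k \in g.2) && (c == (g.1, g.2 :\ k)))); last exact: hP.
case: ifP => hk /=; last by rewrite big_pred0.
rewrite (big_pred1 (g.1, g.2 :\ k)) //= dpart_oddE /= !inE eqxx /= ffunE eqxx mulr1 setD1K //.
rewrite big1 ?mul1r; last by move=> i _; rewrite hz bin0.
have -> : [set x : 'I_n * 'I_n | (x.1 \in [set k]) && (x.2 \in g.2 :\ k) && (x.2 < x.1)%N]
          = pair k @: [set c in g.2 :\ k | (c < k)%N].
  apply/setP => -[c d]; rewrite !inE /=; apply/idP/imsetP.
    by case/andP => /andP [/eqP -> h1] h2; exists d; rewrite // !inE h1 h2.
  by case=> e; rewrite !inE => h [-> ->]; rewrite eqxx.
rewrite card_imset; last by move=> c d [].
by rewrite mulrA -expr2 sqrr_sign mul1r; case: g {hP} hk.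
Qed.

Lemma dpart_x1 k i : dpart i (x1 k) = if i == rshift (2 * r) k then basisO F (z, set0) else 0.
Proof.
apply/ffunP => g; case: eqP => [->|hi].
  rewrite dpart_oddE !ffunE /= [in RHS](surjective_pairing g) !xpair_eqE; case: ifP => hk.
    have /negbTE -> : g.2 != set0 by apply/set0Pn; exists k.
    by rewrite andbF.
  case: (eqVneq g.2 set0) => [h0|h0].
    rewrite h0 setU0 eqxx (_ : [set a0 in set0 | _] = set0) ?cards0 ?mul1r //.
    by apply/setP => c; rewrite !inE.
  suff /negbTE -> : k |: g.2 != [set k] by rewrite !andbF mulr0.
  apply: contra h0 => /eqP e; apply/eqP/setP => c.
  move/setP/(_ c): e; rewrite !inE; by case: eqP => [-> _|_ /= ->].
rewrite [RHS]ffunE; apply/eqP; apply: contra_notT hi.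
case: (split_ordP i) => l -> h0.
  have [_ /(_ l)] := dpart_even_basis h0.
  by rewrite hz eqxx addn1.
have [_ /= /setP/(_ l)] := dpart_odd_basis h0.
by rewrite !inE eqxx /= => /eqP ->.
Qed.

Lemma mulO1 f : mulO f (basisO F (z, set0)) = f.
Proof.
apply/ffunP => g; rewrite ffunE (bigD1 g) //= [X in _ + X]big1 ?addr0; last first.
  move=> c hc; apply: big1 => d /andP [/andP [/forallP h1 /eqP h2] _].
  rewrite ffunE; case: eqP => [e|_]; last by rewrite mulr0.
  case/negP: hc; apply/eqP; case: g h1 h2 => g1 g2 /=; rewrite e /= setU0 => h1 ->.
  case: c h1 => c1 c2 /= h1; congr (_, _); apply/ffunP => i; apply: val_inj.
  by move/eqP: (h1 i); rewrite hz addn0 => /esym.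
rewrite (bigD1 (z, set0)) /=; last first.
  rewrite setU0 eqxx -setI_eq0 setI0 eqxx !andbT.
  by apply/forallP => i; rewrite hz addn0.
rewrite [X in _ + X]big1 ?addr0; last by move=> d /andP [_ /negbTE hd]; rewrite ffunE hd mulr0.
rewrite ffunE eqxx mulr1 big1; last by move=> i _; rewrite binn.
rewrite (_ : [set x | _] = set0) ?cards0 ?mul1r //.
by apply/setP => c; rewrite !inE andbF.
Qed.

Lemma actW_x1 E k : actW E (x1 k) = E (rshift (2 * r) k).
Proof.
rewrite /actW (bigD1 (rshift (2 * r) k)) //= dpart_x1 eqxx mulO1 big1 ?addr0 //.
by move=> i /negbTE hi; rewrite dpart_x1 hi mulO0.
Qed.

Lemma dpart_x2 k l : k != l ->
  dpart (rshift (2 * r) k) (basisO F (z, k |: [set l])) = (-1) ^+ (l < k)%N *: x1 l.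
Proof.
move=> hkl; apply/ffunP => g; rewrite dpart_oddE !ffunE /=.
case: ifP => hk.
  case: eqP => [e|_]; last by rewrite scaler0.
  by move: hk; rewrite e inE (negbTE hkl).
rewrite /= !xpair_eqE.
have -> : (k |: g.2 == k |: [set l]) = (g.2 == [set l]).
  apply/eqP/eqP => [e|-> //].
  by rewrite -(setU1K (negbT hk)) e setU1K // inE.
rewrite [in RHS](surjective_pairing g) xpair_eqE.
case: (eqVneq g.2 [set l]) => [->|_]; last by rewrite andbF mulr0 scaler0.
congr (_ * _); congr (_ ^+ _).
case: ltnP => hlk.
  rewrite (_ : [set _ | _] = [set l]) ?cards1 //.
  by apply/setP => c; rewrite !inE; case: eqP => // ->.
rewrite (_ : [set _ | _] = set0) ?cards0 //.
by apply/setP => c; rewrite !inE; case: eqP => // ->; rewrite ltnNge hlk.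
Qed.

Let T : Wder F p r n t := DH (basisO F (z, [set a; b])).

(** Since an index [a] exists, the even number n is positive, hence n/2 > 0. *)
Lemma ltn_ab : (a < b)%N.
Proof. have /= := hab; have := ltn_ord a; move: hn; lia. Qed.

Lemma neq_ab : a != b.
Proof. by have := ltn_ab; rewrite ltn_neqAle => /andP []. Qed.

Lemma iprime_a : iprime (rshift (2 * r) a) = rshift (2 * r) b.
Proof.
(* From b = a + n/2 < n with n even, a lies in the first half of the odd indices. *)
apply: ord_inj; rewrite iprime_val /primen /=.
have := ltn_ord b; have /= := hab; move: hn; do ![case: ifP => ?]; lia.
Qed.

Lemma iprime_b : iprime (rshift (2 * r) b) = rshift (2 * r) a.
Proof. by rewrite -iprime_a iprimeK. Qed.

Lemma tau_rshift k : tau F (rshift (2 * r) k) = 1.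
Proof. by rewrite /tau /= ltnNge leq_addr andbF. Qed.

(** Because d_a(x_a x_b) = x_b is the coefficient at a' = b, and d_b(x_a x_b) = -x_a the one at b' =
    a. All other partial derivatives of x_a x_b vanish. *)
Lemma torusE j : T j =
  if j == rshift (2 * r) b then x1 b else if j == rshift (2 * r) a then - x1 a else 0.
Proof.
rewrite /T DH_basisE /=; last by rewrite cards2 neq_ab.
case: eqP => [->|hjb].
  by rewrite iprime_b tau_rshift scale1r dpart_x2 ?neq_ab // ltnNge ltnW ?ltn_ab // scale1r.
case: eqP => [->|hja].
  rewrite iprime_a tau_rshift scale1r setUC dpart_x2 1?eq_sym ?neq_ab // ltn_ab.
  by rewrite scaleN1r.
apply/ffunP => g; rewrite [RHS]ffunE ffunE.
suff -> : dpart (iprime j) (basisO F (z, [set a; b])) g = 0 by rewrite scaler0.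
apply/eqP/negPn/negP; case: (split_ordP (iprime j)) => l e; rewrite e.
  by case/dpart_even_basis => _ /(_ l); rewrite hz eqxx addn1.
case/dpart_odd_basis => _ /= /setP/(_ l); rewrite !inE eqxx /= => /orP [] /eqP h.
  by apply: hjb; rewrite -[j]iprimeK e h iprime_a.
by apply: hja; rewrite -[j]iprimeK e h iprime_b.
Qed.

Lemma torus_even : parW false T = T.
Proof.
apply/ffunP => j; rewrite ffunE torusE.
case: eqP => [->|_]; first by rewrite mu_rshift parO_basis //= cards1.
case: eqP => [->|_]; last by apply/ffunP => g; rewrite !ffunE; case: ifP.
rewrite mu_rshift; apply/ffunP => g; rewrite !ffunE.
by case: (eqVneq g (z, [set a])) => [->|_]; [rewrite cards1 | case: ifP; rewrite oppr0].
Qed.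

Lemma torus_deg0 : Wdeg 0 T.
Proof.
have hx k g : x1 k g != 0 -> (zdeg g)%:Z - 1 = 0.
  rewrite ffunE; case: (eqVneq g _) => [-> _|_]; last by rewrite eqxx.
  by rewrite /zdeg cards1 big1 // => i _; rewrite hz.
move=> j g; rewrite torusE; case: ifP => _; first exact: hx.
case: ifP => _; last by rewrite ffunE eqxx.
by rewrite ffunE oppr_eq0; apply: hx.
Qed.

Lemma actW_torus f g : actW T f g = ((b \in g.2)%:R - (a \in g.2)%:R) * f g.
Proof.
have hba : rshift (2 * r) a != rshift (2 * r) b.
  by rewrite (inj_eq (@rshift_inj _ _)) neq_ab.
rewrite /actW (bigD1 (rshift (2 * r) b)) //= (bigD1 (rshift (2 * r) a)) //=.
rewrite big1 ?addr0; last first.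
  by move=> i /andP [/negbTE h1 /negbTE h2]; rewrite torusE h1 h2 mul0O.
rewrite !torusE eqxx (negbTE hba) eqxx mulNO ffunE [X in _ + X]ffunE !mulO_x1_dpart.
by case: (b \in _); case: (a \in _); rewrite mulrBl ?mul1r ?mul0r.
Qed.

(* [odd_wt b - odd_wt a] is the weight of x^(alpha) x^u d_j, with g = (alpha, u), for the pair a, b = a'. *)
Definition odd_wt (c : 'I_n) g j : int := (c \in g.2)%:Z - (j == rshift (2 * r) c)%:Z.

(** The action of T on coefficients gives the terms in u. The remaining term -E(T_j) survives only
    for j in {a, b}, where it equals E_a or -E_b and accounts for the factor d_j. *)
Lemma bracket_torus E j g :
  bracket T E j g = (odd_wt b g j - odd_wt a g j)%:~R * E j g.
Proof.
have hba : rshift (2 * r) a != rshift (2 * r) b.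
  by rewrite (inj_eq (@rshift_inj _ _)) neq_ab.
rewrite bracket_even ?torus_even // ffunE [X in _ + X]ffunE actW_torus torusE /odd_wt.
rewrite !rmorphB /=.
case: eqP => [->|_].
  by rewrite actW_x1 eq_sym (negbTE hba) subr0 -{2}[E _ _]mul1r -mulrBl addrAC.
case: eqP => [->|_]; last by rewrite actW0r ffunE !subr0.
by rewrite actWN actW_x1 ffunE !subr0 opprK -{2}[E _ _]mul1r -mulrDl opprB addrA addrAC.
Qed.

(** All terms of D_H(x^(alpha) x^u) have the weight of x^u: removing x_a raises the weight by 1,
    while the accompanying d_b lowers it by 1; for x_b and d_a the signs are reversed. Other
    derivatives affect neither count. *)
Lemma DH_basis_wt h j g : ~~ odd #|h.2| -> DH (basisO F h) j g != 0 ->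
  odd_wt b g j - odd_wt a g j = (b \in h.2)%:Z - (a \in h.2)%:Z.
Proof.
move=> ho; rewrite DH_basisE // ffunE => hj.
have {hj}: dpart (iprime j) (basisO F h) g != 0.
  by apply: contraNneq hj => ->; rewrite scaler0.
have -> : odd_wt b g j = (b \in g.2)%:Z - (iprime j == rshift (2 * r) a)%:Z.
  by rewrite /odd_wt (inv_eq iprimeK) iprime_a.
have -> : odd_wt a g j = (a \in g.2)%:Z - (iprime j == rshift (2 * r) b)%:Z.
  by rewrite /odd_wt (inv_eq iprimeK) iprime_b.
case: (split_ordP (iprime j)) => l -> hl.
  by case: (dpart_even_basis hl) => -> _; rewrite !eq_lrshift !subr0.
case: (dpart_odd_basis hl) => hlg ->; rewrite !eq_rshift !inE ![_ == l]eq_sym.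
case: (eqVneq l a) hlg => [->|_]; first by rewrite (negbTE neq_ab) => /negbTE -> /=; rewrite !subr0.
case: (eqVneq l b) => [->|_ _]; last by rewrite !subr0.
by move=> /negbTE -> /=; rewrite !subr0 sub0r opprB.
Qed.

Lemma bracket_torus_DH h : ~~ odd #|h.2| ->
  bracket T (DH (basisO F h)) = ((b \in h.2)%:Z - (a \in h.2)%:Z)%:~R *: DH (basisO F h).
Proof.
move=> ho; apply/ffunP => j; apply/ffunP => g; rewrite bracket_torus WscaleE.
case: (eqVneq (DH (basisO F h) j g) 0) => [->|hE]; first by rewrite !mulr0.
by rewrite (DH_basis_wt ho hE).
Qed.

End Torus.

(** * H_0 as a linear subspace *)

Section InH0.
Variables (F : fieldType) (p r n : nat) (t : 'I_(2*r) -> nat).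

Lemma inH0_0 : inH0 (0 : Wder F p r n t).
Proof. by exists (fun _ => 0); rewrite big1 // => g _; rewrite scale0r. Qed.

Lemma inH0D (D E : Wder F p r n t) : inH0 D -> inH0 E -> inH0 (D + E).
Proof.
move=> [c ->] [d ->]; exists (fun g => c g + d g).
by rewrite -big_split; apply: eq_bigr => g _; rewrite scalerDl.
Qed.

Lemma inH0Z (x : F) (D : Wder F p r n t) : inH0 D -> inH0 (x *: D).
Proof.
move=> [c ->]; exists (fun g => x * c g).
by rewrite scaler_sumr; apply: eq_bigr => g _; rewrite scalerA.
Qed.

Lemma inH0_DH (h : mon p n t) : hgen h -> inH0 (DH (basisO F h)).
Proof.
move=> hh; exists (fun g => (g == h)%:R).
rewrite (bigD1 h) //= eqxx scale1r big1 ?addr0 //.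
by move=> g /andP [_ /negbTE ->]; rewrite scale0r.
Qed.

End InH0.

(** * Counting over the odd indices, and the vanishing of phi *)

Lemma sum_mem_card (n : nat) (A : {set 'I_n}) : (\sum_(k < n) (k \in A) = #|A|)%N.
Proof. by rewrite -sum1_card [RHS]big_mkcond; apply: eq_bigr => k _; case: ifP. Qed.

Lemma sum_eq_rshift (r n : nat) (j : 'I_(2*r + n)) :
  (\sum_(k < n) (j == rshift (2 * r) k) = mu j)%N.
Proof.
case: (split_ordP j) => l ->.
  by rewrite mu_lshift big1 // => k _; rewrite eq_lrshift.
rewrite mu_rshift (bigD1 l) //= eqxx big1 // => k /negbTE hk.
by rewrite eq_rshift eq_sym hk.
Qed.

Theorem theorem4p9 (F : closedFieldType) (p r n : nat) (t : 'I_(2*r) -> nat)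
  (hp : prime p) (hp3 : (3 < p)%N) (hchar : p \in [pchar F])
  (hr : (0 < r)%N) (hn : (0 < n)%N) (hneven : ~~ odd n)
  (ht : forall i, (0 < t i)%N)
  (phi : Wder F p r n t -> Wder F p r n t)
  (hlin : forall (a : F) (x y : Wder F p r n t),
      inH0 x -> inH0 y -> phi (a *: x + y) = a *: phi x + phi y)
  (hodd : forall x, inH0 x -> Wodd (phi x))
  (hhom : exists d : int, forall (k : int) (x : Wder F p r n t),
      inH0 x -> Wdeg k x -> Wdeg (k + d) (phi x))
  (hder : forall x y, inH0 x -> inH0 y ->
      phi (bracket x y) = bracket (phi x) y + bracket x (phi y))
  (hm1 : forall x, inH0 x -> Wdeg (-1) x -> phi x = 0)
  (h0 : forall x, inH0 x -> Wdeg 0 x -> phi x = 0) :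
  forall x, inH0 x -> phi x = 0.
Proof.
have phi0 : phi 0 = 0.
  apply: (addrI (phi 0)); rewrite addr0.
  by have := hlin 1 0 0 (@inH0_0 _ _ _ _ _) (@inH0_0 _ _ _ _ _); rewrite !scale1r addr0 => /esym.
suff phi_DH (h : mon p n t) : hgen h -> phi (DH (basisO F h)) = 0.
  (* Membership in H_0 is carried through the induction because phi is assumed linear only there. *)
  move=> x [c ->]; pose K x := inH0 x /\ phi x = 0.
  suff: K (\sum_(g | hgen g) c g *: DH (basisO F g)) by case.
  apply: big_ind => [|x1 x2 [hx1 e1] [hx2 e2]|g hg].
  - by split; first exact: inH0_0.
  - by split; [exact: inH0D | rewrite -[x1]scale1r hlin // e1 e2 scaler0 addr0].
  - have hD := inH0_DH F hg; split; first exact: inH0Z.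
    by rewrite -[_ *: _]addr0 hlin ?phi_DH ?phi0 ?scaler0 ?addr0 //; exact: inH0_0.
move=> hh; have hD := inH0_DH F hh; have /andP [ho _] := hh.
set D := DH _ in hD *.
have pt_gt0 i : (0 < p ^ t i)%N by rewrite expn_gt0 prime_gt0.
pose z : dexp p t := [ffun i => Ordinal (pt_gt0 i)].
have hz i : val (z i) = 0%N by rewrite ffunE.
(* Suppose that phi(D) has a nonzero coefficient at the monomial g of component j; the aim is a
   parity contradiction. *)
apply/ffunP => j; apply/ffunP => g; rewrite !ffunE; apply/eqP/negPn/negP => hne.
have wt_eq (a b : 'I_n) : val b = (val a + n./2)%N ->
    odd_wt b g j - odd_wt a g j = (b \in h.2)%:Z - (a \in h.2)%:Z.
  move=> hab; pose T : Wder F p r n t := DH (basisO F (z, [set a; b])).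
  have hT : inH0 T.
    apply: inH0_DH; rewrite /hgen /= cards2 (neq_ab hneven hab) /=.
    (* The monomial x_a x_b is not the excluded top one: the top exponent p^t - 1 is positive at
       index 0, which exists as r > 0. *)
    have r2_gt0 : (0 < 2 * r)%N by rewrite muln_gt0.
    apply/negP => /andP [/forallP /(_ (Ordinal r2_gt0))] /=.
    have := ltn_exp2l 0 (t (Ordinal r2_gt0)) (prime_gt1 hp).
    rewrite expn0 ht hz; lia.
  have phiT : phi T = 0 by apply: (h0 T hT); exact: (torus_deg0 hz hneven hab).
  have brT (E : Wder F p r n t) := bracket_torus hz hneven hab E j g.
  have brTD : bracket T D = _ *: D := bracket_torus_DH F hz hneven hab ho.
  rewrite -/T in brT; clearbody T.
  (* With phi(T) = 0, applying phi to [T, D] = c D gives c phi(D) = [T, phi(D)]. Comparing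
     coefficients at (j, g) and cancelling the nonzero one equates the two weights in F. *)
  have := hder _ _ hT hD.
  rewrite phiT bracket0l add0r brTD -[_ *: _]addr0 (hlin _ _ _ hD (@inH0_0 _ _ _ _ _)).
  rewrite phi0 addr0 => /ffunP/(_ j)/ffunP/(_ g); rewrite brT WscaleE => e.
  apply/eqP; rewrite -subr_eq0; apply/eqP/(intr_small_eq0 hchar).
    by rewrite (leq_ltn_trans (weight_gap_le3 _ _ _ _ _ _)).
  by apply: (mulIf hne); rewrite mul0r rmorphB mulrBl -e subrr.
(* As phi(D) is odd, |u| + mu(j) is odd for every monomial that occurs. *)
have hpar : odd #|g.2| (+) mu j.
  have := hodd _ hD => /ffunP /(_ j) /ffunP /(_ g); rewrite !ffunE.
  case: ifP => [/eqP -> _|_ e]; first by case: (mu j).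
  by move: hne; rewrite -e eqxx.
(* The total of G is |g| + |h| + mu(j). The weight equalities make it even pair by pair, whereas |h|
   is even and |g| + mu(j) is odd. *)
pose G (k : 'I_n) := ((k \in g.2) + (k \in h.2) + (j == rshift (2 * r) k))%N.
have : ~~ odd (\sum_(k < n) G k).
  apply: (@sum_even_pairs _ n./2); first by rewrite addnn even_halfK.
  by move=> a b hab; apply: weight_parity; exact: wt_eq.
rewrite !big_split /= !sum_mem_card sum_eq_rshift !oddD (negbTE ho) addbF oddb.
by rewrite hpar.
Qed.
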